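(* Let $\mathbb{F}_q$ be a finite field, $\mathcal{V}$ a vector space over $\mathbb{F}_q$, and $k,t$ integers with $0\le t\le k$. Let $n\ge 3$ and let $\mathcal{C}=\{\pi_1,\ldots,\pi_n\}$ be a $(k,k-t)$-SCID in $\mathcal{V}$. Define $S:=\langle \pi_1,\ldots,\pi_n\rangle$ and $I:=\langle \pi_i\cap\pi_j \mid 1\le i<j\le n\rangle$. Then \[\dim S+\dim I\le (n-1)k+2t.\]
   Context: A $(k,k-t)$-SCID is a set of (distinct) $k$-dimensional subspaces of $\mathcal{V}$, containing at least two elements, such that any two distinct members intersect in a subspace of dimension exactly $k-t$. $\langle\cdot\rangle$ denotes the span. *)

(* Defs.v *)
From HB Require Import structures.
From mathcomp Require Import all_boot all_order all_algebra.
From mathcomp Require Import boolp classical_sets.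

Set Implicit Arguments.
Unset Strict Implicit.
Unset Printing Implicit Defensive.

Import GRing.Theory.

Local Open Scope classical_set_scope.
Local Open Scope ring_scope.

(* The ambient space is an arbitrary [lmodType] over a field and may have
   infinite dimension, so [vectType] and [{vspace _}], which are finite
   dimensional by construction, do not apply: subspaces are predicates. *)

Definition is_subspace (F : fieldType) (V : lmodType F) (U : set V) : Prop :=
  submod_closed (mem U).

Definition lspan (F : fieldType) (V : lmodType F) (A : set V) : set V :=
  smallest (@is_subspace F V) A.

Definition lin_indep (F : fieldType) (V : lmodType F) (d : nat)
    (e : 'I_d -> V) : Prop :=
  forall c : 'I_d -> F, \sum_(i < d) c i *: e i = 0 -> forall i, c i = 0.

(* "dim U = d": U has a basis of d vectors. In particular U is then a
   subspace, of finite dimension; d is unique by invariance of dimension. *)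
Definition has_dim (F : fieldType) (V : lmodType F) (U : set V) (d : nat) :
    Prop :=
  exists e : 'I_d -> V, lin_indep e /\ lspan (range e) = U.

Definition SCID (F : fieldType) (V : lmodType F) (k r : nat)
    (C : set (set V)) : Prop :=
  [/\ forall U, C U -> is_subspace U /\ has_dim U k,
      exists U W, [/\ C U, C W & U <> W]
    & forall U W, C U -> C W -> U <> W -> has_dim (U `&` W) r].

(* Main.v *)
Require Import Defs.
From HB Require Import structures.
From mathcomp Require Import all_boot all_order all_algebra.
From mathcomp Require Import boolp classical_sets.
From mathcomp Require Import zify.

(** Order the subspaces and write [S_m], [I_m] for the two spans formed from
    the first [m] of them. Adjoining [U = pi_(m+1)] enlarges [S_m] by
    [k - dim (S_m ∩ U)] and [I_m] by [dim J - dim (I_m ∩ J)], where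
    [J = \sum_i (pi_i ∩ U)] is contained in [S_m ∩ U]. Hence [dim S + dim I]
    grows by at most [k - dim (I_m ∩ J)], in particular by at most [k].
    It starts at [2k] for two subspaces, and at the third step [I_2 ∩ J]
    contains the triple intersection, of dimension at least [k - 2t].
    The infinite dimensional ambient space is replaced by the coordinate space
    of [S]. *)

Set Implicit Arguments.
Unset Strict Implicit.
Unset Printing Implicit Defensive.

Local Open Scope classical_set_scope.
Local Open Scope ring_scope.
Import GRing.Theory.

(** * The dimension count for a sequence of finite dimensional subspaces *)

Section VspaceBound.
Variables (F : fieldType) (vT : vectType F) (U : nat -> {vspace vT}).

Definition sum_space (n : nat) : {vspace vT} := (\sum_(i < n) U i)%VS.

(** Pairs are grouped by their larger index, so that adjoining one subspace adds a single summand to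
    [cap_space]. *)
Definition meet_space (j : nat) : {vspace vT} := (\sum_(i < j) (U i :&: U j))%VS.

Definition cap_space (n : nat) : {vspace vT} := (\sum_(j < n) meet_space j)%VS.

Lemma meet_space_sub (j : nat) : (meet_space j <= sum_space j :&: U j)%VS.
Proof.
apply/subv_sumP => i _; apply: capvS (subvv _).
exact: (sumv_sup i).
Qed.

(** The loss [\dim (sum_space n :&: U n)] in the first sum outweighs the gain [\dim (meet_space n)]
    in the second. The additive form avoids truncated subtraction. *)
Lemma dim_step (n : nat) :
  (\dim (sum_space n.+1) + \dim (cap_space n.+1)
     + \dim (cap_space n :&: meet_space n)
   <= \dim (sum_space n) + \dim (cap_space n) + \dim (U n))%N.
Proof.
rewrite /sum_space /cap_space !big_ord_recr /= -/(sum_space n) -/(cap_space n).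
have := dimv_sum_cap (sum_space n) (U n).
have := dimv_sum_cap (cap_space n) (meet_space n).
have := dimvS (meet_space_sub n).
lia.
Qed.

(** Two subspaces of dimension [k - t] inside [U 0], of dimension [k], meet in dimension at least
    [k - 2t]. *)
Lemma dim_triple_cap (k t : nat) :
  (forall i, i < 3 -> \dim (U i) = k)%N ->
  (forall i j, i < j < 3 -> \dim (U i :&: U j) = k - t)%N ->
  (k <= \dim (cap_space 2 :&: meet_space 2) + 2 * t)%N.
Proof.
move=> dimU dimUU.
have sub2 : ((U 0 :&: U 1) :&: (U 0 :&: U 2) <= cap_space 2 :&: meet_space 2)%VS.
  apply: capvS; rewrite /cap_space /meet_space !big_ord_recr !big_ord0 /=.
    by rewrite !add0v.
  by rewrite add0v addvSl.
have subU : ((U 0 :&: U 1) + (U 0 :&: U 2) <= U 0)%VS.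
  by rewrite subv_add !capvSl.
have := dimv_sum_cap (U 0 :&: U 1)%VS (U 0 :&: U 2)%VS.
have := dimvS sub2; have := dimvS subU.
by rewrite dimU // !dimUU //; lia.
Qed.

Lemma dim_sum_cap_space (k t n : nat) :
  (t <= k)%N ->
  (forall i, i < n.+3 -> \dim (U i) = k)%N ->
  (forall i j, i < j < n.+3 -> \dim (U i :&: U j) = k - t)%N ->
  (\dim (sum_space n.+3) + \dim (cap_space n.+3) <= n.+2 * k + 2 * t)%N.
Proof.
move=> le_tk; elim: n => [|n IHn] dimU dimUU.
  (* The first two steps contribute at most [k] each, the third at most [k - (k - 2t) = 2t]. *)
  have := dim_step 2; have := dim_triple_cap dimU dimUU.
  have := dim_step 1; have := dim_step 0.
  rewrite !dimU // /sum_space /cap_space !big_ord0 dimv0.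
  lia.
have := dim_step n.+3; rewrite dimU //.
have : (\dim (sum_space n.+3) + \dim (cap_space n.+3) <= n.+2 * k + 2 * t)%N.
  by apply: IHn => [i lti|i j ltij]; [apply: dimU | apply: dimUU]; lia.
lia.
Qed.

End VspaceBound.

(** * Spans and finite generation for subspaces given as predicates *)

Section Lspan.
Variables (F : fieldType) (V : lmodType F).
Implicit Types A B : set V.

Lemma is_subspaceP A :
  is_subspace A <-> A 0 /\ forall a x y, A x -> A y -> A (a *: x + y).
Proof.
split=> -[A0 AD]; split.
- exact: set_mem.
- by move=> a x y Ax Ay; apply/set_mem/AD; apply: mem_set.
- exact: mem_set.
- by move=> a x y /set_mem Ax /set_mem Ay; apply/mem_set/AD.
Qed.

Lemma subspace_sum A (I : finType) (P : pred I) (c : I -> F) (v : I -> V) :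
  is_subspace A -> (forall i, P i -> A (v i)) -> A (\sum_(i | P i) c i *: v i).
Proof.
move=> /is_subspaceP[A0 AD] Av; elim/big_ind: _ => // [x y Ax Ay|i /Av Avi].
  by rewrite -[x]scale1r; apply: AD.
by rewrite -[_ *: _]addr0; apply: AD.
Qed.

Lemma is_subspace_lspan A : is_subspace (lspan A).
Proof.
apply/is_subspaceP; split=> [B [/is_subspaceP[]]//|a x y Ax Ay B subB].
by case: (subB) => /is_subspaceP[_ BD] _; apply: BD; [apply: Ax|apply: Ay].
Qed.

Lemma sub_lspan A : A `<=` lspan A.
Proof. by move=> x Ax B [_]; apply. Qed.

Lemma lspan_min A B : is_subspace B -> A `<=` B -> lspan A `<=` B.
Proof. by move=> subB AB x; apply. Qed.

Lemma lspan_range (n : nat) (g : 'I_n -> V) :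
  lspan (range g) = range (fun c : 'I_n -> F => \sum_(i < n) c i *: g i).
Proof.
apply/seteqP; split; last first.
  move=> _ [c _ <-]; apply: subspace_sum; first exact: is_subspace_lspan.
  by move=> i _; apply: sub_lspan; exists i.
apply: lspan_min.
  apply/is_subspaceP; split.
    by exists (fun=> 0) => //; apply: big1 => i _; rewrite scale0r.
  move=> a _ _ [c _ <-] [d _ <-]; exists (fun i => a * c i + d i) => //.
  rewrite scaler_sumr -big_split; apply: eq_bigr => i _.
  by rewrite scalerDl scalerA.
move=> _ [j _ <-]; exists (fun i => (i == j)%:R) => //.
rewrite (bigD1 j) //= eqxx scale1r big1 ?addr0 // => i /negPf->.
exact: scale0r.
Qed.

Lemma lspan_range_lift (n : nat) (g : 'I_n.+1 -> V) (c : 'I_n.+1 -> F) j :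
  \sum_i c i *: g i = 0 -> c j != 0 ->
  lspan (range (g \o lift j)) = lspan (range g).
Proof.
move=> cg0 cj0; apply/seteqP; split; apply: lspan_min;
  try exact: is_subspace_lspan.
  by move=> _ [i _ <-]; apply: sub_lspan; exists (lift j i).
move=> _ [i _ <-]; case: (unliftP j i) => [i' ->|->].
  by apply: sub_lspan; exists i'.
(* The relation is solved for [g j], its coefficient being invertible. *)
have -> : g j = \sum_(i | i != j) (- (c j)^-1 * c i) *: g i.
  under eq_bigr do rewrite -scalerA.
  rewrite -scaler_sumr; move: cg0; rewrite (bigD1 j) //= => /eqP.
  rewrite addrC addr_eq0 => /eqP->.
  by rewrite scalerN scaleNr opprK scalerA mulVf // scale1r.
apply: subspace_sum; first exact: is_subspace_lspan.
move=> i'; rewrite eq_sym => /unlift_some[l -> _].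
by apply: sub_lspan; exists l.
Qed.

(* A generating family of least cardinality is independent. *)
Lemma lspan_range_has_dim (n : nat) (g : 'I_n -> V) :
  exists d, has_dim (lspan (range g)) d.
Proof.
pose P d := `[< exists e : 'I_d -> V, lspan (range e) = lspan (range g) >].
have exP : exists d, P d by exists n; apply/asboolP; exists g.
case: (ex_minnP exP) => d /asboolP[e eg] dmin; exists d, e; split=> // c ce0 j.
apply/eqP/negPn/negP => cj0.
case: d e eg dmin c ce0 j cj0 => [|d] e eg dmin c ce0 j cj0; first by case: j cj0.
have /dmin : P d.
  by apply/asboolP; exists (e \o lift j); rewrite (lspan_range_lift ce0).
by rewrite ltnn.
Qed.

(** Bases of all the [A i], concatenated into one finite family, generate the span. This makes [S]
    finite dimensional. *)
Lemma lspan_bigcup_has_dim (I : finType) (A : I -> set V) (k : nat) :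
  (forall i, has_dim (A i) k) -> exists d, has_dim (lspan (\bigcup_i A i)) d.
Proof.
move=> /choice[e eA].
pose g (m : 'I_#|{: I * 'I_k}|) := let p := enum_val m in e p.1 p.2.
suff -> : lspan (\bigcup_i A i) = lspan (range g) by exact: lspan_range_has_dim.
apply/seteqP; split; apply: lspan_min; try exact: is_subspace_lspan.
  move=> x [i _]; case: (eA i) => _ <-; apply: lspan_min.
    exact: is_subspace_lspan.
  move=> _ [j _ <-]; apply: sub_lspan; exists (enum_rank (i, j)) => //.
  by rewrite /g enum_rankK.
move=> _ [m _ <-]; apply: sub_lspan; exists (enum_val m).1 => //.
by case: (eA (enum_val m).1) => _ <-; apply: sub_lspan; exists (enum_val m).2.
Qed.

End Lspan.

(** * Transport of subspaces along an injective linear map *)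

Section Transfer.
Variables (F : fieldType) (V : lmodType F) (vT : vectType F).
Variable (f : {linear vT -> V}).
Hypothesis f_inj : injective f.

Definition vimage (U : {vspace vT}) : set V := [set f v | v in [set v | v \in U]].

Lemma is_subspace_vimage (U : {vspace vT}) : is_subspace (vimage U).
Proof.
apply/is_subspaceP; split; first by exists 0; rewrite /= ?mem0v ?linear0.
move=> a _ _ [x Ux <-] [y Uy <-]; exists (a *: x + y); last by rewrite linearP.
by rewrite /= memvD ?memvZ.
Qed.

Lemma vimage_inj : injective vimage.
Proof.
move=> U W UW; apply/vspaceP => v; apply/idP/idP => vU.
  have : vimage W (f v) by rewrite -UW; exists v.
  by case=> w Ww /f_inj <-.
have : vimage U (f v) by rewrite UW; exists v.
by case=> w Ww /f_inj <-.
Qed.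

Lemma vimage_cap (U W : {vspace vT}) : vimage (U :&: W) = vimage U `&` vimage W.
Proof.
apply/seteqP; split=> [_ [v /memv_capP[Uv Wv] <-]|_ [[v Uv <-] [w Ww /f_inj wv]]].
  by split; exists v.
by exists v => //; apply/memv_capP; split=> //; rewrite -wv.
Qed.

Lemma lspan_vimage (n : nat) (v : 'I_n -> vT) :
  lspan (range (f \o v)) = vimage <<mktuple v>>.
Proof.
rewrite lspan_range; apply/seteqP; split.
  move=> _ [c _ <-]; exists (\sum_i c i *: v i).
    apply: memv_suml => i _; apply/memvZ/memv_span; apply/tnthP; exists i.
    by rewrite tnth_mktuple.
  by rewrite linear_sum; apply: eq_bigr => i _; rewrite linearZ.
(* The family may be dependent: [coord] still selects coefficients that reproduce any [w] in its
   span. *)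
move=> _ [w Uw <-]; exists (coord (mktuple v) ^~ w) => //.
rewrite [in RHS](coord_span Uw) linear_sum; apply: eq_bigr => i _.
by rewrite linearZ /= (nth_map i) ?size_enum_ord // nth_ord_enum.
Qed.

Lemma has_dim_vimage (U : {vspace vT}) : has_dim (vimage U) (\dim U).
Proof.
exists (f \o tnth (vbasis U)); split; last first.
  have tupleE : mktuple (tnth (vbasis U)) = vbasis U.
    by apply: eq_from_tnth => i; rewrite tnth_mktuple.
  by rewrite lspan_vimage tupleE (span_basis (vbasisP U)).
move=> c; have -> : \sum_i c i *: (f \o tnth (vbasis U)) i =
    f (\sum_i c i *: (vbasis U)`_i).
  rewrite linear_sum; apply: eq_bigr => i _.
  by rewrite linearZ /= (tnth_nth 0).
rewrite -[X in _ = X](linear0 f) => /f_inj.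
exact/freeP/basis_free/vbasisP.
Qed.

(** A basis of [A] is lifted through [f]; a relation among the lifts maps to one among the basis
    vectors, so the lifts are free. *)
Lemma vimage_of_has_dim (A : set V) (d : nat) :
  A `<=` range f -> has_dim A d -> exists2 U, \dim U = d & A = vimage U.
Proof.
move=> Af [e [e_free eA]].
have /choice[v fv] i : exists v, f v = e i.
  have [|v _ <-] := Af (e i); last by exists v.
  by rewrite -eA; apply: sub_lspan; exists i.
have -> : A = vimage <<mktuple v>>.
  rewrite -eA -lspan_vimage; suff -> : e = f \o v by [].
  by apply/funext => i /=; rewrite fv.
exists <<mktuple v>>%VS => //.
suff /eqP-> : free (mktuple v) by rewrite size_tuple.
apply/freeP => c cv0; apply: e_free.
transitivity (f 0); last exact: linear0.
rewrite -[in RHS]cv0 linear_sum; apply: eq_bigr => i _.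
by rewrite linearZ /= (nth_map i) ?size_enum_ord // nth_ord_enum fv.
Qed.

Lemma lspan_bigcup_vimage (I : finType) (P : pred I) (U : I -> {vspace vT}) :
  lspan (\bigcup_(i in [set i | P i]) vimage (U i))
  = vimage (\sum_(i | P i) U i)%VS.
Proof.
apply/seteqP; split.
  apply: lspan_min; first exact: is_subspace_vimage.
  move=> _ [i Pi [v Uv <-]]; exists v => //=.
  by apply: subvP Uv; apply: (sumv_sup i).
move=> _ [v /memv_sumP[w Uw ->] <-].
rewrite linear_sum (eq_bigr (fun i => 1 *: f (w i))); last first.
  by move=> i _; rewrite scale1r.
apply: subspace_sum; first exact: is_subspace_lspan.
by move=> i Pi; apply: sub_lspan; exists i => //; exists (w i) => //; apply: Uw.
Qed.

End Transfer.

(** * The coordinate space of an independent family *)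

Section Coordinates.
Variables (F : fieldType) (V : lmodType F) (d : nat) (e : 'I_d -> V).

Definition lincomb (c : 'rV[F]_d) : V := \sum_i c 0 i *: e i.

Fact lincomb_is_linear : linear lincomb.
Proof.
move=> a x y; rewrite /lincomb scaler_sumr -big_split; apply: eq_bigr => i _.
by rewrite !mxE scalerDl scalerA.
Qed.

HB.instance Definition _ :=
  GRing.isLinear.Build F 'rV[F]_d V _ lincomb lincomb_is_linear.

Lemma lincomb_inj : lin_indep e -> injective lincomb.
Proof.
move=> e_free x y /eqP; rewrite -subr_eq0 -linearB /= => /eqP/e_free xy0.
by apply/rowP => i; apply/eqP; rewrite -subr_eq0; have := xy0 i; rewrite !mxE => ->.
Qed.

Lemma lspan_sub_lincomb : lspan (range e) `<=` range lincomb.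
Proof.
rewrite lspan_range => _ [c _ <-]; exists (\row_i c i) => //.
by apply: eq_bigr => i _; rewrite mxE.
Qed.

End Coordinates.

(** * Reindexing of the pairs, and the theorem *)

Lemma cap_space_pairs (F : fieldType) (vT : vectType F) (n : nat)
    (U : nat -> {vspace vT}) :
  (\sum_(p : 'I_n * 'I_n | (p.1 < p.2)%N) (U p.1 :&: U p.2) = cap_space U n)%VS.
Proof.
rewrite -(pair_big_dep xpredT (fun i j : 'I_n => (i < j)%N)
  (fun i j => U i :&: U j)%VS) /=.
rewrite (exchange_big_dep xpredT) //=; apply: eq_bigr => j _.
rewrite /meet_space (big_ord_widen n (fun i => U i :&: U j)%VS) //.
exact: ltnW.
Qed.

Theorem theorem3 (F : finFieldType) (V : lmodType F) (k t n : nat)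
    (pi : 'I_n -> set V) :
  (t <= k)%N -> (3 <= n)%N ->
  injective pi -> SCID k (k - t)%N (range pi) ->
  let S := lspan (\bigcup_i pi i) in
  let I := lspan (\bigcup_(p in [set p : 'I_n * 'I_n | (p.1 < p.2)%N])
                    (pi p.1 `&` pi p.2)) in
  exists dS dI : nat,
    [/\ has_dim S dS, has_dim I dI & (dS + dI <= (n - 1) * k + 2 * t)%N].
Proof.
case: n pi => [|[|[|n]]] // pi le_tk _ pi_inj [dim_pi _ dim_cap] S I.
have dimk i : has_dim (pi i) k by case: (dim_pi (pi i)) => //; exists i.
(* A basis [e] of [S] identifies [S], and hence every [pi i], with subspaces of ['rV[F]_d]. *)
have [d [e [e_free eS]]] := lspan_bigcup_has_dim dimk.
pose f : {linear 'rV[F]_d -> V} := lincomb e.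
have f_inj : injective f by exact: lincomb_inj.
have /choice[W W_pi] i : exists U, \dim U = k /\ pi i = vimage f U.
  have [|U dimU piU] := vimage_of_has_dim (f := f) _ (dimk i); last by exists U.
  move=> x pix; apply: lspan_sub_lincomb; rewrite eS.
  by apply: sub_lspan; exists i.
(* The family is extended to all naturals; past the last index [inord] returns 0, outside the range
   of the bound. *)
pose U m := W (inord m).
have UE (i : 'I_n.+3) : U i = W i by rewrite /U inord_val.
have piE i : pi i = vimage f (U i) by rewrite UE; case: (W_pi i).
have SE : S = vimage f (sum_space U n.+3).
  rewrite -(lspan_bigcup_vimage f xpredT); congr lspan.
  by apply: eq_bigcup => // i _.
have IE : I = vimage f (cap_space U n.+3).
  rewrite -cap_space_pairs -lspan_bigcup_vimage; congr lspan.
  by apply: eq_bigcupr => p _; rewrite vimage_cap // -!piE.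
exists (\dim (sum_space U n.+3)), (\dim (cap_space U n.+3)).
rewrite SE IE; split; try exact: has_dim_vimage.
rewrite subn1; apply: dim_sum_cap_space => // [i _|i j /andP[ltij ltj]].
  by case: (W_pi (inord i)).
have ltin := ltn_trans ltij ltj.
(* The SCID condition concerns distinct members, which injectivity of [pi] provides from [i < j]. *)
pose i' := Ordinal ltin; pose j' := Ordinal ltj.
have neq_ij : pi i' <> pi j'.
  by move=> /pi_inj /(congr1 val) /= ij; rewrite ij ltnn in ltij.
have : has_dim (vimage f (U i :&: U j)) (k - t).
  rewrite vimage_cap // -(piE i') -(piE j').
  by apply: dim_cap neq_ij; [exists i' | exists j'].
(* Some [X] of dimension [k - t] has the same image as [U i :&: U j], hence equals it. *)
case/(vimage_of_has_dim (f := f)) => [_ [v _ <-]|X <- XE]; first by exists v.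
by rewrite (vimage_inj f_inj XE).
Qed.
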